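(* Let $A\in\mathcal{M}_n(\mathbb{C})$ with $n\ge2$. The equations $e^{XA-AX}=X$ and $XA-AX=\log(X)$ have the same solutions; that is, for $X\in\mathcal{M}_n(\mathbb{C})$, one has $e^{XA-AX}=X$ if and only if $X$ has no eigenvalues on $\mathbb{R}^-=\{x\in\mathbb{R}\mid x\le0\}$ and $XA-AX=\log(X)$.
   Context: For a matrix $X\in\mathcal{M}_n(\mathbb{C})$ with no eigenvalues on $\mathbb{R}^-$, $\log(X)$ denotes the principal logarithm: the matrix $U\in\mathcal{M}_n(\mathbb{C})$ such that $e^U=X$ and all eigenvalues of $U$ lie in $\{z\in\mathbb{C}\mid \Im(z)\in(-\pi,\pi)\}$. *)

(* Defs.v *)
From HB Require Import structures.
From mathcomp Require Import all_boot all_order all_algebra.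
From mathcomp Require Import complex.
From mathcomp Require Import all_classical all_reals all_analysis.

Set Implicit Arguments.
Unset Strict Implicit.
Unset Printing Implicit Defensive.

Import Order.TTheory GRing.Theory Num.Theory.
Import numFieldNormedType.Exports.

Local Open Scope classical_set_scope.
Local Open Scope ring_scope.
Local Open Scope complex_scope.

(* The field is abstract because the library puts the norm topology on an
   abstract [K : numClosedFieldType] but not directly on the type [R[i]]; at
   [K := R[i]] the topology of ['M[R[i]]_n] is the usual one. *)
Definition expmx (K : numClosedFieldType) (n : nat) (U : 'M[K]_n) : 'M[K]_n :=
  lim (series (fun k : nat => k`!%:R^-1 *: U ^+ k) @ \oo).

Section PrincipalLogarithm.
Variables (R : realType) (n : nat).
Implicit Types X U : 'M[R[i]]_n.

Definition no_nonpos_eigenvalue X : Prop :=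
  forall x : R, x <= 0 -> ~~ eigenvalue X x%:C.

Definition is_principal_log X U : Prop :=
  expmx U = X /\
  forall z : R[i], eigenvalue U z -> - pi < complex.Im z < pi.

(* Meaningful under [no_nonpos_eigenvalue X], which ensures that exactly one
   [U] satisfies [is_principal_log X U]; the default value 0 is otherwise
   irrelevant. *)
Definition logmx X : 'M[R[i]]_n := xget 0 [set U | is_principal_log X U].

End PrincipalLogarithm.

(* Main.v *)
Require Import Defs.
From HB Require Import structures.
From mathcomp Require Import all_boot all_order all_algebra.
From mathcomp Require Import complex.
From mathcomp Require Import all_classical all_reals all_analysis.
From mathcomp Require Import lra.

Set Implicit Arguments.
Unset Strict Implicit.
Unset Printing Implicit Defensive.

Import Order.TTheory GRing.Theory Num.Theory.
Import numFieldNormedType.Exports.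

Local Open Scope ring_scope.
Local Open Scope complex_scope.

(**
Write U = XA - AX. If exp U = X, then U commutes with X, which is the sum of a
power series in U. By Jacobson's lemma (commutator_nilpotent) a commutator
XA - AX that commutes with X is nilpotent, so X is unipotent: 1 is its only
eigenvalue. Hence X has no eigenvalue on the closed negative half-line, U is a
principal logarithm of X because 0 is its only eigenvalue, and U is the
principal logarithm by uniqueness (principal_log_unique). Conversely, if X has
no eigenvalue on that half-line, then a principal logarithm exists
(principal_log_exists), so exp (log X) = X.

Both facts about principal logarithms are proved without Jordan forms.
A common eigenvector of commuting matrices turns statements on spectra into
scalar ones, in particular a matrix without nonzero eigenvalue is nilpotent.

Existence: let p interpolate the scalar principal logarithm on the spectrum of
X and put Q = p(X). Then X^-1 exp Q - 1 has no nonzero eigenvalue, so it is a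
nilpotent matrix N. Newton's correction Q := Q - N replaces N by a multiple of
N ^ 2, and finitely many corrections make N vanish (principal_log_newton).
The logarithm W so obtained commutes with every matrix that commutes with X.

Uniqueness: any principal logarithm U of X commutes with X, hence with W.
A common eigenvector of U - W and W, together with the injectivity of the
exponential on the strip |Im z| < pi, shows that N = U - W is nilpotent. Then
exp U = exp N exp W forces exp N = 1, hence N = 0.

On the analytic side, only the convergence of the exponential series over R[i],
the value of its sum on scalars, and the identity exp (U + N) = exp U exp N for
a nilpotent N commuting with U are needed. The last one follows from a finite
rearrangement of partial sums (expmx_seriesD_nilpotent).
*)

(** * Eigenvectors, nilpotent matrices and interpolation *)

Lemma comm_mx_common_eigenvector (C : numClosedFieldType) (n : nat)
    (A B : 'M[C]_n) (a : C) :
  comm_mx A B -> eigenvalue A a ->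
  exists v : 'rV_n, exists b : C,
    [/\ v != 0, v *m A = a *: v & v *m B = b *: v].
Proof.
move=> AB aA; set W := eigenspace A a.
have W_gt0 : (0 < \rank W)%N by rewrite lt0n mxrank_eq0.
have [b /eigenvalueP[w wB w0]] := eigenvalue_closed (restrictmx W B) W_gt0.
have WB : stablemx W B by exact: comm_mx_stable_eigenspace.
have vW : (w *m row_base W <= W)%MS by rewrite mulmx_sub // eq_row_base.
have /eigenvectorP[c vc] : stablemx (w *m row_base W) B.
  rewrite -stablemx_restrict //; apply/eigenvectorP.
  by exists b; exact/eigenspaceP.
exists (w *m row_base W), c; split; try exact/eigenspaceP.
by rewrite mulmx_free_eq0 ?row_base_free.
Qed.

Lemma eigenvector_exp (F : fieldType) (n : nat) (A : 'M[F]_n) (v : 'rV_n)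
    (a : F) (k : nat) : v *m A = a *: v -> v *m A ^+ k = a ^+ k *: v.
Proof.
move=> vA; elim: k => [|k IH]; first by rewrite !expr0 mulmx1 scale1r.
by rewrite exprS -mulmxE mulmxA vA -scalemxAl IH scalerA exprS.
Qed.

Lemma eigenvector_horner_mx (F : fieldType) (n : nat) (A : 'M[F]_n.+1)
    (v : 'rV_n.+1) (a : F) (p : {poly F}) :
  v *m A = a *: v -> v *m horner_mx A p = p.[a] *: v.
Proof.
move=> vA; elim/poly_ind: p => [|p c IH].
  by rewrite rmorph0 horner0 mulmx0 scale0r.
rewrite rmorphD rmorphM /= horner_mx_X horner_mx_C mulmxDr -mulmxE mulmxA IH.
by rewrite -scalemxAl vA scalerA mul_mx_scalar -scalerDl !hornerE.
Qed.

Lemma nilpotent_eigenvalue (F : fieldType) (n : nat) (N : 'M[F]_n) (m : nat)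
    (a : F) : N ^+ m = 0 -> eigenvalue N a -> a = 0.
Proof.
move=> Nm /eigenvalueP[v vN v0].
have := eigenvector_exp m vN; rewrite Nm mulmx0 => /esym/eqP.
rewrite scaler_eq0 (negbTE v0) orbF expf_eq0 => /andP[_ /eqP//].
Qed.

Lemma eigenvalues0_nilpotent (C : numClosedFieldType) (n : nat)
    (N : 'M[C]_n.+1) :
  (forall a, eigenvalue N a -> a = 0) -> exists m, N ^+ m.+1 = 0.
Proof.
move=> N0; have [rs rsE] := closed_field_poly_normal (char_poly N).
rewrite (monicP (char_poly_monic N)) scale1r in rsE.
have rs0 r : r \in rs -> r = 0.
  by move=> rrs; apply: N0; rewrite eigenvalue_root_char rsE root_prod_XsubC.
exists (size rs); have := Cayley_Hamilton N; rewrite rsE big_seq.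
rewrite (eq_bigr (fun=> 'X)) => [|r /rs0->]; last by rewrite subr0.
rewrite -big_seq big_const_seq count_predT.
have -> m : iter m ( *%R ('X : {poly C})) 1 = 'X^m.
  by elim: m => [|m IH]; rewrite ?expr0 //= IH -exprS.
by rewrite rmorphXn /= horner_mx_X exprS => ->; rewrite mulr0.
Qed.

(** Newton's form of the interpolation polynomial, built one node at a time. *)
Lemma horner_interpolation (F : fieldType) (f : F -> F) (s : seq F) :
  exists p : {poly F}, {in s, forall x, p.[x] = f x}.
Proof.
elim: s => [|x s [p ps]]; first by exists 0.
have [xs|xs] := boolP (x \in s).
  by exists p => y; rewrite inE => /orP[/eqP->|]; exact: ps.
set q := \prod_(y <- s) ('X - y%:P).
have qx : q.[x] != 0 by rewrite -rootE root_prod_XsubC.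
exists (p + ((f x - p.[x]) / q.[x]) *: q) => y; rewrite !hornerE inE.
have [->|yx] /= := eqVneq y x; first by move=> _; rewrite divfK // addrC subrK.
move=> ys; have /eqP -> : q.[y] == 0 by rewrite -rootE root_prod_XsubC.
by rewrite mulr0 addr0 ps.
Qed.

(** * Commutators that commute with one of their factors *)

(** The derivation [., A] acts on polynomials in X as p |-> p'(X) [X, A] as soon
    as [X, A] commutes with X. *)
Lemma commutator_horner_mx (F : fieldType) (n : nat) (A X : 'M[F]_n.+1)
    (p : {poly F}) :
  let U := X * A - A * X in X * U = U * X ->
  horner_mx X p * A - A * horner_mx X p = horner_mx X p^`() * U.
Proof.
move=> U XU; elim/poly_ind: p => [|p c IH].
  by rewrite deriv0 !rmorph0 mul0r mulr0 subr0 mul0r.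
rewrite derivD derivM derivX derivC mulr1 addr0 !rmorphD !rmorphM /=.
rewrite horner_mx_X horner_mx_C; set P := horner_mx X p in IH *.
set P' := horner_mx X p^`() in IH *.
have cA : c%:M * A = A * c%:M by rewrite -!mulmxE scalar_mxC.
rewrite mulrDl mulrDr cA opprD addrACA subrr addr0 mulrDl.
rewrite -[P' * X * U]mulrA XU [P' * (U * X)]mulrA -IH mulrBl !mulrA.
rewrite /U mulrBr !mulrA.
by rewrite [RHS]addrC subrKA.
Qed.

(** Jacobson's lemma. Starting from p(X) = 0 with p the characteristic
    polynomial, bracketing with A repeatedly shows that each derivative of p at
    X is annihilated by a power of U. The derivative of order deg p is a nonzero
    constant in characteristic 0. *)
Lemma commutator_nilpotent (F : numFieldType) (n : nat) (A X : 'M[F]_n.+1) :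
  let U := X * A - A * X in X * U = U * X -> exists m, U ^+ m = 0.
Proof.
move=> U XU; pose p := char_poly X.
have UP q m : horner_mx X q * U ^+ m = U ^+ m * horner_mx X q.
  have /comm_horner_mx : comm_mx X (U ^+ m) by exact: commrX.
  by move=> /(_ q).
have step k : exists m, horner_mx X p^`(k) * U ^+ m = 0.
  elim: k => [|k [m IH]].
    by exists 0; rewrite derivn0 Cayley_Hamilton mul0r.
  (* Bracket P U^m = 0 with A, then multiply by U^m on the left to remove the
     term P [U^m, A]. *)
  exists (m + m.+1)%N; rewrite derivnS; set q := p^`(k) in IH *.
  set P := horner_mx X q in IH *; set P' := horner_mx X q^`().
  have PA : P * A = A * P + P' * U.
    by rewrite -[P' * U](commutator_horner_mx q XU) addrC subrK.
  have : P' * U ^+ m.+1 = - (P * (U ^+ m * A - A * U ^+ m)).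
    rewrite mulrBr !mulrA IH mul0r sub0r opprK PA mulrDl -mulrA IH mulr0 add0r.
    by rewrite exprS mulrA.
  move=> E; rewrite exprD mulrA UP -[U ^+ m * _ * _]mulrA E {E}.
  by rewrite mulrN mulrA -UP IH mul0r oppr0.
have [m] := step n.+1.
have sp : size p = n.+2 by rewrite size_char_poly.
have -> : p^`(n.+1) = (n.+1`!%:R)%:P.
  apply/polyP => i; rewrite coef_derivn coefC.
  case: i => [|i] /=; last first.
    by rewrite nth_default ?mul0rn // sp addnS ltnS leq_addr.
  rewrite addn0 ffactnn; have : lead_coef p = 1 by exact/monicP/char_poly_monic.
  by rewrite lead_coefE sp => ->.
rewrite horner_mx_C -mulmxE mul_scalar_mx => /eqP; rewrite scaler_eq0.
by rewrite pnatr_eq0 eqn0Ngt fact_gt0 => /eqP; exists m.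
Qed.

(** * Limits of matrices and partial sums of the exponential series *)

Section MatrixExponentialSeries.
Local Open Scope classical_set_scope.

(** The sequence of partial sums whose limit is [expmx U]. *)
Definition expmx_series (K : numFieldType) (n : nat) (U : 'M[K]_n) :
    nat -> 'M[K]_n :=
  series (fun k : nat => k`!%:R^-1 *: U ^+ k).

(** The exponential series cut before degree m; this is the exponential of U
    when U ^ m = 0. *)
Definition trunc_expmx (K : numFieldType) (n : nat) (m : nat) (U : 'M[K]_n) :
    'M[K]_n :=
  \sum_(j < m) j`!%:R^-1 *: U ^+ j.

Context (K : numFieldType).

Lemma cvg_mx (m n : nat) (u : nat -> 'M[K]_(m, n)) (l : 'M[K]_(m, n)) :
  (forall i j, u k i j @[k --> \oo] --> l i j) -> u @ \oo --> l.
Proof.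
move=> ul A [P lP PA].
have uP : \forall k \near \oo, forall i j, P i j (u k i j).
  apply: filter_forall => i; apply: filter_forall => j.
  exact: (ul i j (P i j) (lP i j)).
by apply: filterS uP => k; exact: PA.
Qed.

Lemma cvg_coord (m n : nat) (u : nat -> 'M[K]_(m, n)) (l : 'M[K]_(m, n)) i j :
  u @ \oo --> l -> u k i j @[k --> \oo] --> l i j.
Proof.
move=> ul.
exact: (cvg_comp u (fun M : 'M[K]_(m, n) => M i j) ul
  (@coord_continuous K m n i j l)).
Qed.

Lemma cvg_mx_unique (m n : nat) (u : nat -> 'M[K]_(m, n))
    (l l' : 'M[K]_(m, n)) :
  u @ \oo --> l -> u @ \oo --> l' -> l = l'.
Proof. exact: (@cvg_unique _ (@norm_hausdorff K 'M[K]_(m, n))). Qed.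

Lemma cvg_mulmxr (m n p : nat) (u : nat -> 'M[K]_(m, n)) (l : 'M[K]_(m, n))
    (B : 'M[K]_(n, p)) :
  u @ \oo --> l -> u k *m B @[k --> \oo] --> l *m B.
Proof.
move=> ul; apply: cvg_mx => i j; rewrite mxE.
under eq_cvg do rewrite mxE.
apply: cvg_big => [|a _]; first exact: add_continuous.
by apply: cvgMr_tmp; exact: cvg_coord.
Qed.

Lemma cvg_mulmxl (m n p : nat) (u : nat -> 'M[K]_(n, p)) (l : 'M[K]_(n, p))
    (B : 'M[K]_(m, n)) :
  u @ \oo --> l -> B *m u k @[k --> \oo] --> B *m l.
Proof.
move=> ul; apply: cvg_mx => i j; rewrite mxE.
under eq_cvg do rewrite mxE.
apply: cvg_big => [|a _]; first exact: add_continuous.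
by apply: cvgMl_tmp; exact: cvg_coord.
Qed.

Lemma expmx_series_comm (n : nat) (U V E : 'M[K]_n) :
  expmx_series U @ \oo --> E -> comm_mx V U -> comm_mx V E.
Proof.
move=> UE VU; apply: (cvg_mx_unique (cvg_mulmxl (B := V) UE)).
under eq_cvg => k.
  rewrite (_ : V *m _ = expmx_series U k *m V); first over.
  rewrite /expmx_series /series /= mulmx_suml mulmx_sumr.
  apply: eq_bigr => i _; rewrite -scalemxAl -scalemxAr; congr (_ *: _).
  exact: (commrX i VU).
exact: cvg_mulmxr.
Qed.

Lemma expmx_series_eigenvector (n : nat) (U E : 'M[K]_n) (v : 'rV[K]_n)
    (a e : K) :
  expmx_series U @ \oo --> E -> v *m U = a *: v ->
  series (fun k : nat => k`!%:R^-1 * a ^+ k) @ \oo --> e ->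
  v *m E = e *: v.
Proof.
move=> UE vU ae; apply: (cvg_mx_unique (cvg_mulmxl (B := v) UE)).
under eq_cvg => k.
  rewrite (_ : v *m _ = series (fun k : nat => k`!%:R^-1 * a ^+ k) k *: v);
    first over.
  rewrite /expmx_series /series /= mulmx_sumr scaler_suml.
  apply: eq_bigr => i _; rewrite -scalemxAr -scalerA; congr (_ *: _).
  exact: eigenvector_exp.
exact: cvgZr_tmp.
Qed.

Lemma eq_sum_ord_vanish (V : nmodType) (F : nat -> V) (m p : nat) :
  (forall j, (m <= j)%N || (p <= j)%N -> F j = 0) ->
  \sum_(j < m) F j = \sum_(j < p) F j.
Proof.
move=> F0; wlog mp : m p F0 / (m <= p)%N.
  move=> H; have [mp|/ltnW pm] := leqP m p; first exact: H.
  by apply/esym/H => // j jmp; apply: F0; rewrite orbC.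
rewrite (big_ord_widen _ F mp) big_mkcond; apply: eq_bigr => j _.
by case: ltnP => // mj; rewrite F0 ?mj.
Qed.

(** Exact rearrangement of the partial sums, by the binomial formula. *)
Lemma expmx_seriesD (n N : nat) (U V : 'M[K]_n) :
  comm_mx U V ->
  expmx_series (U + V) N =
  \sum_(j < N) (j`!%:R^-1 *: V ^+ j) *m expmx_series U (N - j)%N.
Proof.
move=> UV; have seriesS (W : 'M[K]_n) k :
    expmx_series W k.+1 = expmx_series W k + k`!%:R^-1 *: W ^+ k.
  by rewrite /expmx_series /series /= big_nat_recr.
have series0 (W : 'M[K]_n) : expmx_series W 0 = 0.
  by rewrite /expmx_series /series /= big_geq.
elim: N => [|N IH]; first by rewrite series0 big_ord0.
transitivity (\sum_(j < N.+1) ((j`!%:R^-1 *: V ^+ j) *m expmx_series U (N - j)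
    + (j`!%:R^-1 *: V ^+ j) *m ((N - j)`!%:R^-1 *: U ^+ (N - j)))); last first.
  by apply: eq_bigr => j _; rewrite -mulmxDr subSn ?seriesS // -ltnS.
rewrite seriesS IH big_split /= big_ord_recr /= subnn series0 mulmx0 addr0.
congr (_ + _); rewrite exprDn_comm // scaler_sumr; apply: eq_bigr => j _.
have jN : (j <= N)%N by rewrite -ltnS.
rewrite -scalemxAl -scalemxAr.
have -> (a : K) k (W : 'M[K]_n) : a *: (W *+ k) = (a * k%:R) *: W.
  by rewrite -scaler_nat; exact: scalerA.
have -> (a b : K) (W : 'M[K]_n) : a *: (b *: W) = (a * b) *: W.
  exact: scalerA.
congr (_ *: _).
  rewrite -(bin_fact jN) !natrM !invfM mulrC mulVKf //.
  by rewrite pnatr_eq0 -lt0n bin_gt0.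
by apply: commrX; apply/commr_sym/commrX.
Qed.

(** When V ^ m = 0 the number of terms does not depend on N, so the limit in N
    can be taken termwise. *)
Lemma expmx_seriesD_nilpotent (n m N : nat) (U V : 'M[K]_n) :
  comm_mx U V -> V ^+ m = 0 ->
  expmx_series (U + V) N =
  \sum_(j < m) (j`!%:R^-1 *: V ^+ j) *m expmx_series U (N - j)%N.
Proof.
move=> UV Vm; rewrite expmx_seriesD //.
pose F j := (j`!%:R^-1 *: V ^+ j) *m expmx_series U (N - j)%N.
apply: (@eq_sum_ord_vanish _ F) => j; rewrite /F.
move=> /orP[Nj|mj].
  have /eqP -> : (N - j == 0)%N by rewrite subn_eq0.
  by rewrite /expmx_series /series /= big_geq ?mulmx0.
by rewrite -(subnKC mj) exprD Vm mul0r scaler0 mul0mx.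
Qed.

Lemma cvg_expmx_seriesD (n m : nat) (U V E : 'M[K]_n) :
  comm_mx U V -> V ^+ m = 0 -> expmx_series U @ \oo --> E ->
  expmx_series (U + V) @ \oo --> trunc_expmx m V *m E.
Proof.
move=> UV Vm UE; rewrite /trunc_expmx mulmx_suml.
under eq_cvg do rewrite (expmx_seriesD_nilpotent _ UV Vm).
apply: cvg_big => [|j _]; first exact: add_continuous.
by apply: cvg_mulmxl; rewrite cvg_centern.
Qed.

End MatrixExponentialSeries.

(** * The scalar complex exponential and the convergence of the series *)

Section ComplexExponential.
Local Open Scope classical_set_scope.

(** Partial sums of the exponential series of a scalar. *)
Definition exp_series (K : numFieldType) (a : K) : nat -> K :=
  series (fun k : nat => k`!%:R^-1 * a ^+ k).

(** The case of 1 x 1 matrices of [expmx_seriesD]. *)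
Lemma exp_seriesD (K : numFieldType) (a b : K) (N : nat) :
  exp_series (a + b) N =
  \sum_(j < N) (j`!%:R^-1 * b ^+ j) * exp_series a (N - j)%N.
Proof.
have scalarX (c : K) k : (c%:M : 'M[K]_1) ^+ k = (c ^+ k)%:M.
  by elim: k => [|k IH]; rewrite ?expr0 // !exprS IH -mulmxE -scalar_mxM.
have expmx_seriesE (c : K) k :
    expmx_series (c%:M : 'M[K]_1) k = (exp_series c k)%:M.
  rewrite /expmx_series /exp_series /series /= raddf_sum; apply: eq_bigr => i _.
  by rewrite scalarX scale_scalar_mx.
have /matrixP/(_ 0 0) := @expmx_seriesD K 1 N a%:M b%:M (scalar_mxC _ _).
rewrite -raddfD /= expmx_seriesE mxE summxE mulr1n => ->; apply: eq_bigr => j _.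
by rewrite scalarX scale_scalar_mx expmx_seriesE -scalar_mxM mxE mulr1n.
Qed.

(** The left-hand side is a sum of monomials in a and b with nonnegative
    coefficients, so it is bounded by its value at the norms of a and b. This
    reduces the functional equation of the complex exponential to the real
    one. *)
Lemma exp_series_mul_dist (K : numFieldType) (a b : K) (N : nat) :
  `|exp_series a N * exp_series b N - exp_series (a + b) N| <=
  exp_series `|a| N * exp_series `|b| N - exp_series (`|a| + `|b|) N.
Proof.
have E (c d : K) : exp_series c N * exp_series d N - exp_series (c + d) N =
    \sum_(j < N) (j`!%:R^-1 * d ^+ j) *
      \sum_(N - j <= i < N) i`!%:R^-1 * c ^+ i.
  rewrite exp_seriesD mulrC {1}/exp_series /series /= big_mkord mulr_suml.
  rewrite -sumrB.
  apply: eq_bigr => j _; rewrite -mulrBr; congr (_ * _).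
  by rewrite /exp_series sub_series_geq // leq_subr.
rewrite !E; apply: le_trans (ler_norm_sum _ _ _) _; apply: ler_sum => j _.
have tn (c : K) i : `|i`!%:R^-1 * c ^+ i| = i`!%:R^-1 * `|c| ^+ i.
  by rewrite normrM normrX ger0_norm // invr_ge0 ler0n.
rewrite normrM tn; apply: ler_wpM2l.
  by rewrite mulr_ge0 ?exprn_ge0 ?invr_ge0 ?ler0n.
by apply: le_trans (ler_norm_sum _ _ _) _; apply: ler_sum => i _; rewrite tn.
Qed.

Lemma cvg_dist0 (K : numFieldType) (u v : nat -> K) (l : K) :
  u @ \oo --> l -> u - v @ \oo --> (0 : K) -> v @ \oo --> l.
Proof.
move=> ul uv; rewrite -[l]subr0.
by rewrite (_ : v = u - (u - v)); [exact: cvgB | rewrite opprB addrC subrK].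
Qed.

Context (R : realType).

Lemma normc_le (z : R[i]) : `|z| <= (`|complex.Re z| + `|complex.Im z|)%:C.
Proof.
rewrite normc_def lecR -[leRHS]ger0_norm ?addr_ge0 // -sqrtr_sqr ler_wsqrtr //.
rewrite sqrrD !real_normK ?num_real // -addrA addrCA addrC lerDl.
by rewrite mulrn_wge0 // mulr_ge0.
Qed.

(* The cast gives sequences of complex numbers the norm topology of a
   numClosedFieldType. *)
Local Notation C := (R[i] : numClosedFieldType).

Lemma cvg_complex (u : nat -> C) (z : C) :
  (complex.Re (u k) @[k --> \oo] --> complex.Re z) ->
  (complex.Im (u k) @[k --> \oo] --> complex.Im z) ->
  u @ \oo --> z.
Proof.
move=> /cvgrPdist_lt uRe /cvgrPdist_lt uIm; apply/cvgrPdist_lt => -[e e'] /=.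
rewrite ltcE /= => /andP[/eqP -> e0].
have e2 : 0 < e / 2 by rewrite divr_gt0.
have ReB (v w : R[i]) : complex.Re (v - w) = complex.Re v - complex.Re w.
  by case: v => ? ?; case: w.
have ImB (v w : R[i]) : complex.Im (v - w) = complex.Im v - complex.Im w.
  by case: v => ? ?; case: w.
near=> k; apply: le_lt_trans (normc_le _) _.
rewrite ltcR (splitr e) ReB ImB ltrD //; near: k; [exact: uRe | exact: uIm].
Unshelve. all: by end_near. Qed.

(** The complex exponential in closed form, e^x (cos y + i sin y); it is the sum
    of the exponential series by [cvg_exp_series]. *)
Definition cexp (z : C) : C :=
  (expR (complex.Re z))%:C * (cos (complex.Im z) +i* sin (complex.Im z)).

Lemma exp_series_real (x : R) k :
  exp_series x%:C k = (series (exp_coeff x) k)%:C.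
Proof.
rewrite /exp_series /series /= rmorph_sum; apply: eq_bigr => i _.
by rewrite /exp_coeff /= rmorphM fmorphV rmorph_nat rmorphXn mulrC.
Qed.

Lemma complex_sum (I : Type) (r : seq I) (f g : I -> R) :
  \sum_(i <- r) (f i +i* g i) = (\sum_(i <- r) f i) +i* (\sum_(i <- r) g i).
Proof.
elim: r => [|i r IH]; first by rewrite !big_nil.
by rewrite !big_cons IH.
Qed.

Lemma exp_series_imag (y : R) k :
  exp_series (0 +i* y) k = series (cos_coeff y) k +i* series (sin_coeff y) k.
Proof.
rewrite /exp_series /series /= -complex_sum; apply: eq_bigr => i _.
have -> : 0 +i* y = y%:C * 'i%C by simpc.
rewrite exprMn mulrA -{3}(odd_double_half i) -mul2n exprD exprM sqr_i.
have -> : i`!%:R^-1 * y%:C ^+ i = (y ^+ i / i`!%:R)%:C.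
  by rewrite rmorphM fmorphV rmorph_nat rmorphXn mulrC.
have -> : (-1 : R[i]) ^+ i./2 = ((-1) ^+ i./2)%:C by rewrite rmorphXn rmorphN1.
rewrite /cos_coeff /sin_coeff /= -exprnP.
case: (boolP (odd i)) => oi /=.
  have -> : i.-1./2 = i./2 by rewrite -{1}(odd_double_half i) oi /= doubleK.
  by rewrite expr1; simpc; rewrite [_ * (-1) ^+ _]mulrC mulrA.
by rewrite expr0; simpc; rewrite [_ * (-1) ^+ _]mulrC mulrA.
Qed.

(** The product of the partial sums at x and at iy tends to e^x e^(iy), and it
    differs from the partial sum at x + iy by a sequence that tends to 0. *)
Lemma cvg_exp_series (z : C) : exp_series z @ \oo --> cexp z.
Proof.
have cvgexp (x : R) : series (exp_coeff x) @ \oo --> expR x.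
  exact: is_cvg_series_exp_coeff.
case: z => x y; have -> : x +i* y = x%:C + (0 +i* y) by simpc.
set a := x%:C; set b := 0 +i* y.
have cexpE : cexp (a + b) = (expR x)%:C * (cos y +i* sin y).
  by rewrite /cexp /a /b /= addr0 add0r.
have ab : exp_series a \* exp_series b @ \oo --> cexp (a + b).
  rewrite cexpE; apply: cvgM; apply: cvg_complex => /=.
  - by under eq_cvg do rewrite exp_series_real /=; exact: cvgexp.
  - by under eq_cvg do rewrite exp_series_real /=; exact: cvg_cst.
  - under eq_cvg do rewrite exp_series_imag /=.
    by rewrite unlock; exact: is_cvg_series_cos_coeff.
  - under eq_cvg do rewrite exp_series_imag /=.
    by rewrite unlock; exact: is_cvg_series_sin_coeff.
have d0 : exp_series a \* exp_series b - exp_series (a + b) @ \oo --> (0 : C).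
  pose d k := series (exp_coeff `|x|) k * series (exp_coeff `|y|) k
              - series (exp_coeff (`|x| + `|y|)) k.
  have dc : d @ \oo --> 0.
    rewrite -(subrr (expR `|x| * expR `|y|)) -{2}expRD.
    apply: cvgB; last exact: cvgexp.
    by apply: cvgM; exact: cvgexp.
  have aE : `|a| = `|x|%:C.
    by rewrite normc_def /= expr0n addr0 sqrtr_sqr.
  have bE : `|b| = `|y|%:C.
    by rewrite normc_def /= expr0n add0r sqrtr_sqr.
  apply/cvgrPdist_lt => -[e e'] /=.
  rewrite ltcE /= => /andP[/eqP -> e0].
  move/cvgrPdist_lt: dc => /(_ _ e0); apply: filterS => k dk.
  rewrite sub0r normrN; apply: le_lt_trans (exp_series_mul_dist _ _ _) _.
  rewrite aE bE -rmorphD !exp_series_real -rmorphM -rmorphB ltcR.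
  by apply: le_lt_trans dk; rewrite sub0r normrN ler_norm.
exact: (cvg_dist0 ab d0).
Qed.

(** Dominated convergence of a complex series by a real exponential series,
    through its real and imaginary parts. *)
Lemma cvg_series_complex (w : nat -> C) (c : R) :
  (forall k, `|w k| <= (exp_coeff c k)%:C) ->
  exists z : C, series w @ \oo --> z.
Proof.
move=> wc.
have c0 k : 0 <= exp_coeff c k by rewrite -ler0c; apply: le_trans (wc k).
have dom (f : nat -> R) : (forall k, `|f k| <= exp_coeff c k) ->
    cvgn (series f).
  move=> fc; apply: normed_cvg.
  by apply: series_le_cvg fc _ => //; exact: is_cvg_series_exp_coeff.
have wRe : cvgn (series (fun k => complex.Re (w k))).
  apply: dom => k; rewrite -lecR; apply: le_trans (wc k).
  by rewrite normc_def lecR -sqrtr_sqr ler_wsqrtr // lerDl sqr_ge0.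
have wIm : cvgn (series (fun k => complex.Im (w k))).
  apply: dom => k; rewrite -lecR; apply: le_trans (wc k).
  by rewrite normc_def lecR -sqrtr_sqr ler_wsqrtr // lerDr sqr_ge0.
have wE k : series w k = series (fun k => complex.Re (w k)) k +i*
    series (fun k => complex.Im (w k)) k.
  by rewrite /series /= -complex_sum; apply: eq_bigr => l _; case: (w l).
exists (limn (series (fun k => complex.Re (w k))) +i*
        limn (series (fun k => complex.Im (w k)))).
by apply: cvg_complex; under eq_cvg do rewrite wE /=.
Qed.

(** The sum of the norms of all entries is a submultiplicative bound. *)
Lemma normr_exprmx_le (K : numFieldType) (n k : nat) (U : 'M[K]_n) i j :
  `|(U ^+ k) i j| <= (\sum_a \sum_b `|U a b|) ^+ k.
Proof.
set c := \sum_a _; have c0 : 0 <= c.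
  by rewrite !sumr_ge0 // => ? _; rewrite sumr_ge0.
elim: k i j => [|k IH] i j.
  by rewrite !expr0 mxE; case: (i == j); rewrite ?normr1 // normr0.
rewrite exprSr -mulmxE mxE; apply: le_trans (ler_norm_sum _ _ _) _.
apply: (@le_trans _ _ (\sum_l c ^+ k * `|U l j|)).
  by apply: ler_sum => l _; rewrite normrM ler_wpM2r.
rewrite -mulr_sumr exprSr ler_wpM2l ?exprn_ge0 //; apply: ler_sum => l _.
by rewrite (bigD1 j) //= lerDl sumr_ge0.
Qed.

Lemma cvg_expmx (n : nat) (U : 'M[C]_n) : expmx_series U @ \oo --> expmx U.
Proof.
have [L UL] : exists L : 'M[C]_n, expmx_series U @ \oo --> L.
  pose w i j k : C := k`!%:R^-1 * (U ^+ k) i j.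
  have /choice[L wL] : forall ij : 'I_n * 'I_n, exists z : C,
      series (w ij.1 ij.2) @ \oo --> z.
    move=> [i j] /=; set c := \sum_a \sum_b `|U a b|.
    have c0 : 0 <= c by rewrite !sumr_ge0 // => ? _; rewrite sumr_ge0.
    apply: (@cvg_series_complex _ (complex.Re c)) => k.
    rewrite /exp_coeff /= rmorphM fmorphV rmorph_nat rmorphXn /=.
    rewrite RRe_real ?ger0_real // mulrC /w normrM.
    rewrite ger0_norm ?invr_ge0 ?ler0n //.
    by rewrite ler_wpM2l ?invr_ge0 ?ler0n //; exact: normr_exprmx_le.
  exists (\matrix_(i, j) L (i, j)); apply: cvg_mx => i j; rewrite mxE.
  have := wL (i, j); apply: cvg_trans; apply: near_eq_cvg; near=> k.
  rewrite /expmx_series /series /= summxE.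
  by apply: eq_bigr => l _; rewrite mxE.
suff -> : expmx U = L by [].
by apply: cvg_lim => //; exact: norm_hausdorff.
Unshelve. all: by end_near. Qed.

(** The moduli give x = x', and the cosines give |y| = |y'|. If y = - y', the
    sines show sin y' = 0, so y' = 0 since |y'| < pi. *)
Lemma cexp_inj (z w : C) :
  - pi < complex.Im z < pi -> - pi < complex.Im w < pi -> cexp z = cexp w ->
  z = w.
Proof.
case: z w => [x y] [x' y'] /= yP y'P; rewrite /cexp /=; simpc.
move=> [ec es].
have xx' : x = x'.
  apply: expR_inj; apply/eqP; rewrite -(@eqrXn2 _ 2%N) ?expR_ge0 //; apply/eqP.
  by rewrite -[LHS]mulr1 -[RHS]mulr1 -{1}(cos2Dsin2 y) -(cos2Dsin2 y')
     !mulrDr -!exprMn ec es.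
have e0 : expR x != 0 by rewrite gt_eqF ?expR_gt0.
rewrite -xx' in ec es *; move/(mulfI e0): ec; move/(mulfI e0): es => es ec.
congr (_ +i* _).
have normE (t : R) : - pi < t < pi -> `|t| \in `[0, pi]%R.
  move=> tP; rewrite in_itv /= normr_ge0 /= ler_norml.
  by move: tP => /andP[/ltW -> /ltW ->].
have cosE (t : R) : cos `|t| = cos t.
  by case: (ger0P t) => // _; rewrite cosN.
have /(cos_inj (normE _ yP) (normE _ y'P)) : cos `|y| = cos `|y'|.
  by rewrite !cosE.
move/eqP; rewrite eqr_norm2 => /orP[/eqP//|/eqP yN].
have s0 : sin y' = 0.
  by move: es; rewrite yN sinN => ?; lra.
suff y'0 : y' = 0 by rewrite yN y'0 oppr0.
have [|y'gt0|y'lt0] := ltgtP y' 0; last by [].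
  move=> y'lt0; have := @sin_gt0_pi R (- y').
  rewrite sinN s0 oppr0 ltxx => H; exfalso; suff: false by []; apply: H.
  by case/andP: y'P => ? ?; rewrite oppr_gt0 y'lt0 ltrNl.
have := @sin_gt0_pi R y'.
rewrite s0 ltxx => H; exfalso; suff: false by []; apply: H.
by case/andP: y'P => ? ?; rewrite y'gt0.
Qed.

(** The argument of z is plus or minus the arc cosine of Re z / |z|, according
    to the sign of Im z. *)
Lemma cexp_onto (z : C) : (forall x : R, x <= 0 -> z != x%:C) ->
  exists2 w : C, cexp w = z & - pi < complex.Im w < pi.
Proof.
case: z => x y z_pos; pose r := Num.sqrt (x ^+ 2 + y ^+ 2).
have r2 : r ^+ 2 = x ^+ 2 + y ^+ 2 by rewrite sqr_sqrtr ?addr_ge0 ?sqr_ge0.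
have r_gt0 : 0 < r.
  rewrite sqrtr_gt0 lt_neqAle addr_ge0 ?sqr_ge0 // andbT eq_sym.
  rewrite paddr_eq0 ?sqr_ge0 // !sqrf_eq0; apply/negP => /andP[/eqP x0 /eqP y0].
  by have := z_pos 0 (lexx _); rewrite x0 y0 eqxx.
have xr : `|x| <= r.
  by rewrite -sqrtr_sqr ler_wsqrtr // lerDl sqr_ge0.
have cP : -1 <= x / r <= 1.
  by rewrite -ler_norml normrM normfV (gtr0_norm r_gt0) ler_pdivrMr ?mul1r.
pose t := acos (x / r).
have ct : cos t = x / r by rewrite acosK // in_itv.
have st : sin t = `|y| / r.
  rewrite sin_acos // -[RHS]ger0_norm; last by rewrite divr_ge0 // ltW.
  rewrite -[RHS]sqrtr_sqr; congr (Num.sqrt _).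
  rewrite !expr_div_n real_normK ?num_real //.
  by rewrite r2 -[1](@divff _ (x ^+ 2 + y ^+ 2)) -?r2 ?expf_neq0 ?gt_eqF //
     -mulrBl r2 addrC addKr.
have t_ge0 : 0 <= t by exact: acos_ge0.
(* t = pi would put z on the closed negative half-line. *)
have t_ltpi : t < pi.
  rewrite lt_neqAle acos_lepi // andbT; apply/eqP => tpi.
  move: ct st; rewrite tpi cospi sinpi => cE /esym/eqP.
  rewrite mulf_eq0 invr_eq0 (gt_eqF r_gt0) orbF normr_eq0 => /eqP y0.
  have xE : x = - r by rewrite -[x](@divfK _ r) ?gt_eqF // -cE mulN1r.
  have x_le0 : x <= 0 by rewrite xE oppr_le0 ltW.
  by have := z_pos x x_le0; rewrite y0 eqxx.
pose s := if 0 <= y then t else - t.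
have cs : cos s = x / r by rewrite /s; case: ifP; rewrite ?cosN.
have ss : sin s = y / r.
  rewrite /s; case: ifPn => [y0|]; first by rewrite st ger0_norm.
  by rewrite -ltNge => y0; rewrite sinN st ltr0_norm // mulNr opprK.
exists (ln r +i* s) => /=; last by rewrite /s; case: ifP => _; lra.
rewrite /cexp /= lnK // cs ss; simpc.
by rewrite ![r * _]mulrC !divfK ?gt_eqF.
Qed.

End ComplexExponential.

(** * The matrix exponential over the complex numbers *)

Section MatrixExponential.
Context (R : realType).
Local Notation C := (R[i] : numClosedFieldType).
Implicit Types (n : nat).

Lemma expmx_comm n (U V : 'M[C]_n) : comm_mx V U -> comm_mx V (expmx U).
Proof. exact: (expmx_series_comm (@cvg_expmx R n U)). Qed.

Lemma expmx_eigenvector n (U : 'M[C]_n) (v : 'rV[C]_n) (a : C) :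
  v *m U = a *: v -> v *m expmx U = cexp a *: v.
Proof.
move=> vU.
exact: (expmx_series_eigenvector (@cvg_expmx R n U) vU (@cvg_exp_series R a)).
Qed.

Lemma expmxD_nilpotent n m (U N : 'M[C]_n) :
  comm_mx U N -> N ^+ m = 0 ->
  expmx (U + N) = trunc_expmx m N *m expmx U.
Proof.
move=> UN Nm; have Uc := @cvg_expmx R n U.
apply: (@cvg_mx_unique _ _ _ _ _ _ (@cvg_expmx R n (U + N))).
exact: (cvg_expmx_seriesD UN Nm Uc).
Qed.

(** U lies in the bicommutant of X. *)
Definition in_bicommutant (K : fieldType) n (X U : 'M[K]_n) : Prop :=
  forall V : 'M[K]_n, comm_mx V X -> comm_mx V U.

Lemma trunc_expmx2 (K : numFieldType) n m (N : 'M[K]_n) :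
  exists2 h : 'M[K]_n, in_bicommutant N h &
    trunc_expmx m.+2 N = 1 + N + N ^+ 2 * h.
Proof.
exists (\sum_(j < m) j.+2`!%:R^-1 *: N ^+ j).
  move=> V VN; rewrite /comm_mx mulmx_sumr mulmx_suml; apply: eq_bigr => j _.
  by rewrite -scalemxAr -scalemxAl; congr (_ *: _); exact: (commrX j VN).
rewrite /trunc_expmx 2!big_ord_recl /= !fact0 !factS fact0 muln1 invr1 !scale1r.
rewrite expr0 expr1 addrA; congr (_ + _).
rewrite -mulmxE mulmx_sumr; apply: eq_bigr => j _.
by rewrite -scalemxAr /bump /= !add1n mulmxE -exprD.
Qed.

Lemma trunc_expmx_eq1 (K : numFieldType) n m (N : 'M[K]_n) :
  N ^+ m.+2 = 0 -> trunc_expmx m.+2 N = 1 -> N = 0.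
Proof.
move=> Nm; have [h /(_ N erefl) Nh ->] := trunc_expmx2 m N.
move=> /eqP; rewrite -addrA addrC -subr_eq0 addrK => /eqP E.
(* N = - N^2 h can be substituted into itself as often as wanted. *)
have NE k : N = N * (- (N * h)) ^+ k.
  elim: k => [|k IH]; first by rewrite expr0 mulr1.
  rewrite exprS mulrA mulrN mulrA -expr2.
  have -> : - (N ^+ 2 * h) = N.
    by apply/eqP; rewrite eqr_oppLR -addr_eq0 addrC E.
  exact: IH.
by rewrite (NE m.+2) exprNn exprMn_comm // Nm mul0r !mulr0.
Qed.

Lemma eigenvalue_unit (F : fieldType) n (X : 'M[F]_n.+1) :
  ~~ eigenvalue X 0 -> X \is a GRing.unit.
Proof.
by rewrite /eigenvalue negbK /eigenspace raddf0 subr0 kermx_eq0 row_free_unit.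
Qed.

Lemma expmx_unit n (U : 'M[C]_n.+1) : expmx U \is a GRing.unit.
Proof.
apply: eigenvalue_unit; apply/negP => e0.
have EU : comm_mx (expmx U) U by apply/comm_mx_sym/expmx_comm.
have [v [b [v0 vE /expmx_eigenvector]]] := comm_mx_common_eigenvector EU e0.
rewrite vE scale0r => /esym/eqP; rewrite scaler_eq0 (negbTE v0) orbF.
rewrite /cexp mulf_eq0 => /orP[/eqP[] /eqP|].
  by rewrite gt_eqF // expR_gt0.
rewrite eq_complex /= => /andP[/eqP cb /eqP sb].
have := cos2Dsin2 (complex.Im b).
by rewrite cb sb expr0n addr0 => /eqP; rewrite eq_sym oner_eq0.
Qed.

(** * Existence and uniqueness of the principal logarithm *)

(** The spectrum of U lies in the open strip |Im z| < pi. *)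
Definition in_strip n (U : 'M[C]_n) : Prop :=
  forall z : C, eigenvalue U z -> - pi < complex.Im z < pi.

(** Newton iteration on the equation exp Q = X. With N = X^-1 exp Q - 1,
    X^-1 exp (Q - N) - 1 = exp (- N) (1 + N) - 1 is a multiple of N ^ 2, so the
    nilpotency index decreases. The spectrum of Q - N is contained in that of Q,
    as N is nilpotent and commutes with Q. *)
Lemma principal_log_newton n (X : 'M[C]_n.+1) m (Q : 'M[C]_n.+1) :
  X \is a GRing.unit -> in_bicommutant X Q -> in_strip Q ->
  (X^-1 * expmx Q - 1) ^+ m.+1 = 0 ->
  exists2 U, is_principal_log X U & in_bicommutant X U.
Proof.
move=> Xu; elim: m Q => [|m IH] Q XQ Qs.
  rewrite expr1 => /eqP; rewrite subr_eq0 => /eqP E; exists Q => //; split=> //.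
  by rewrite -[LHS](mulVKr Xu) E mulr1.
set N := _ - 1 => Nm.
have XN : in_bicommutant X N.
  move=> V VX; have VQ := XQ V VX.
  have VE : GRing.comm V (expmx Q) by exact: expmx_comm.
  apply: commrB; last exact: commr1.
  by apply: commrM => //; exact: commrV.
have QN : comm_mx Q N by apply: XN; apply/comm_mx_sym/XQ.
have NX : GRing.comm N X by apply/commr_sym/XN.
have QNn : comm_mx Q (- N) by exact: commrN.
have Nn m' : N ^+ m' = 0 -> (- N) ^+ m' = 0.
  by move=> E; rewrite exprNn E mulr0.
apply: (IH (Q - N)).
- by move=> V VX; apply: commrB; [exact: XQ | exact: XN].
- move=> z.
  have QNN : comm_mx (Q - N) N by apply/commr_sym/commrB => //; exact/commr_sym.
  move=> /(comm_mx_common_eigenvector QNN)[v [b [v0 vQN vN]]].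
  have b0 : b = 0.
    apply: (@nilpotent_eigenvalue _ _ N m.+2) => //.
    by apply/eigenvalueP; exists v.
  apply: Qs; apply/eigenvalueP; exists v => //.
  by move: vQN; rewrite mulmxBr vN b0 scale0r subr0.
- have [h Nh hE] := trunc_expmx2 m (- N).
  rewrite (expmxD_nilpotent QNn (Nn _ Nm)) hE sqrrN mulmxE.
  have -> : expmx Q = X * (1 + N) by rewrite /N addrC subrK mulVKr.
  have XT : GRing.comm X (1 - N + N ^+ 2 * h).
    have XNn : GRing.comm X (- N) by apply/commrN/commr_sym.
    apply: commrD; first by apply: commrD => //; exact: commr1.
    by apply: commrM; [apply/commrX/commr_sym | exact: Nh].
  rewrite [_ * (X * _)]mulrA -XT -mulrA mulKr //.
  have -> : (1 - N + N ^+ 2 * h) * (1 + N) - 1 = N ^+ 2 * (h * (1 + N) - 1).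
    have NN : (1 - N) * (1 + N) = 1 - N ^+ 2.
      by rewrite mulrBl mul1r mulrDr mulr1 -expr2 opprD addrA addrK.
    rewrite mulrDl NN addrC !addrA addNr add0r addrC.
    by rewrite -mulrA -[X in _ - X]mulr1 -mulrBr.
  have Nk : GRing.comm (N ^+ 2) (h * (1 + N) - 1).
    apply/commr_sym/commrX/commr_sym; apply: commrB; last exact: commr1.
    apply: commrM; last by apply: commrD; [exact: commr1|].
    by apply: Nh; exact: commrN.
  have mE : (2 * m.+1 = m.+2 + m)%N by rewrite mul2n -addnn addSnnS addnC.
  rewrite (exprMn_comm m.+1 Nk) -exprM mE exprD.
  by move: Nm => ->; rewrite !mul0r.
Qed.

Lemma principal_log_exists n (X : 'M[C]_n.+1) :
  no_nonpos_eigenvalue X ->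
  exists2 U, is_principal_log X U & in_bicommutant X U.
Proof.
move=> Xpos; have Xu : X \is a GRing.unit by apply/eigenvalue_unit/(Xpos 0).
have logP (z : C) : eigenvalue X z ->
    exists2 w : C, cexp w = z & - pi < complex.Im w < pi.
  move=> Xz; apply: cexp_onto => x x0; apply: contraTneq Xz => ->; exact: Xpos.
pose logs (z : C) :=
  [set w : C | cexp w = z /\ - pi < complex.Im w < pi]%classic.
pose clog (z : C) : C := xget 0 (logs z).
have clogP (z : C) : eigenvalue X z ->
    cexp (clog z) = z /\ - pi < complex.Im (clog z) < pi.
  by move=> /logP[w wz ws]; apply: (@xgetPex _ (0 : C) (logs z)); exists w.
(* rs lists the eigenvalues of X. *)
have [rs rsE] := closed_field_poly_normal (char_poly X).
rewrite (monicP (char_poly_monic X)) scale1r in rsE.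
have [p pP] := horner_interpolation clog rs.
have pE z : eigenvalue X z -> p.[z] = clog z.
  by rewrite eigenvalue_root_char rsE root_prod_XsubC; exact: pP.
pose Q := horner_mx X p.
have XQ : in_bicommutant X Q.
  by move=> V /comm_mx_sym XV; apply/comm_mx_sym/comm_horner_mx.
have QX : comm_mx Q X by apply/comm_mx_sym/XQ.
have Qs : in_strip Q.
  move=> z /(comm_mx_common_eigenvector QX)[v [b [v0 vQ vX]]].
  have Xb : eigenvalue X b by apply/eigenvalueP; exists v.
  have := eigenvector_horner_mx p vX; rewrite vQ => /eqP.
  rewrite -subr_eq0 -scalerBl scaler_eq0 (negbTE v0) orbF subr_eq0 => /eqP ->.
  by rewrite pE //; have [] := clogP b Xb.
set N := X^-1 * expmx Q - 1.
have XN : comm_mx N X.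
  have XE : GRing.comm X (expmx Q) by apply: expmx_comm; exact/comm_mx_sym.
  apply/commr_sym/commrB; last exact: commr1.
  by apply: commrM => //; apply: commrV.
have [|m Nm] := @eigenvalues0_nilpotent C n N.
  move=> z /(comm_mx_common_eigenvector XN)[v [b [v0 vN vX]]].
  have Xb : eigenvalue X b by apply/eigenvalueP; exists v.
  have vQ := eigenvector_horner_mx p vX.
  have vE := expmx_eigenvector vQ.
  have [cb _] := clogP b Xb; rewrite pE // cb -vX in vE.
  have : v *m (X *m N) = 0.
    by rewrite mulmxE mulrBr mulVKr // mulr1 mulmxBr vE subrr.
  rewrite -XN mulmxA vN -scalemxAl vX => /eqP.
  rewrite !scaler_eq0 (negbTE v0) orbF => /orP[/eqP//|/eqP b0].
  by have := Xpos 0 (lexx _); rewrite -[0%:C]b0 Xb.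
exact: (principal_log_newton Xu XQ Qs Nm).
Qed.

Lemma principal_log_comm_unique n (X U V : 'M[C]_n.+1) :
  is_principal_log X U -> is_principal_log X V -> comm_mx U V -> U = V.
Proof.
move=> [UX Us] [VX Vs] UV; pose N := U - V.
have NV : comm_mx N V by apply/commr_sym/commrB => //; exact/commr_sym.
have [|m Nm] := @eigenvalues0_nilpotent C n N.
  move=> z /(comm_mx_common_eigenvector NV)[v [a [v0 vN vV]]].
  have vU : v *m U = (z + a) *: v.
    by rewrite -[U](subrK V) mulmxDr vN vV scalerDl.
  have := expmx_eigenvector vU.
  rewrite UX -VX (expmx_eigenvector vV) => /eqP.
  rewrite -subr_eq0 -scalerBl scaler_eq0 (negbTE v0) orbF subr_eq0 => /eqP.
  move=> /cexp_inj za; suff : a = z + a.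
    by move/eqP; rewrite -subr_eq0 opprD addrCA subrr addr0 oppr_eq0 => /eqP.
  by apply: za; [apply: Vs | apply: Us]; apply/eigenvalueP; exists v.
have Nm2 : N ^+ m.+2 = 0 by rewrite exprSr Nm mul0r.
have := expmxD_nilpotent (comm_mx_sym NV) Nm2.
rewrite addrC subrK UX VX => /esym E.
have Xu : X \is a GRing.unit by rewrite -UX expmx_unit.
apply/eqP; rewrite -subr_eq0; apply/eqP.
apply: (@trunc_expmx_eq1 _ _ m) => //.
by apply: (mulIr Xu); rewrite mul1r -[RHS]E mulmxE.
Qed.

Lemma principal_log_unique n (X U V : 'M[C]_n.+1) :
  no_nonpos_eigenvalue X -> is_principal_log X U -> is_principal_log X V ->
  U = V.
Proof.
move=> /principal_log_exists[W WX XW].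
have E T : is_principal_log X T -> T = W.
  move=> TX; apply: (@principal_log_comm_unique _ X) => //; apply: XW.
  by case: TX => <- _; exact: expmx_comm.
by move=> /E -> /E ->.
Qed.

End MatrixExponential.

Unset Implicit Arguments.

Theorem corollary2 (R : realType) (n : nat) (n_ge2 : (2 <= n)%N)
    (A X : 'M[R[i]]_n) :
  expmx (X *m A - A *m X) = X <->
  no_nonpos_eigenvalue X /\ X *m A - A *m X = logmx X.
Proof.
case: n n_ge2 A X => [//|n] _ A X; set U := _ - _; split=> [UX|[Xpos ->]].
  have XU : comm_mx X U.
    by apply/comm_mx_sym; have := expmx_comm (erefl (U *m U)); rewrite UX.
  have [m Um] : exists m, U ^+ m = 0 by exact: commutator_nilpotent.
  have Ueig z : eigenvalue U z -> z = 0 by exact: (nilpotent_eigenvalue Um).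
  have Xeig z : eigenvalue X z -> z = 1.
    move=> /(comm_mx_common_eigenvector XU)[v [b [v0 vX vU]]].
    have b0 : b = 0 by apply: Ueig; apply/eigenvalueP; exists v.
    have := expmx_eigenvector vU; rewrite UX vX => /eqP.
    rewrite -subr_eq0 -scalerBl scaler_eq0 (negbTE v0) orbF subr_eq0 => /eqP ->.
    by rewrite b0 /cexp /= expR0 cos0 sin0 mul1r.
  have Xpos : no_nonpos_eigenvalue X.
    move=> x x0; apply/negP => /Xeig[x1]; move: x0; rewrite x1.
    by rewrite leNgt ltr01.
  have UlogX : is_principal_log X U.
    by split=> [|z /Ueig ->]; [exact: UX | rewrite /= oppr_lt0 pi_gt0].
  split; first exact: Xpos.
  apply/esym/(xget_unique _ UlogX) => V VlogX.
  exact: (principal_log_unique Xpos VlogX UlogX).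
have [U0 U0X _] := principal_log_exists Xpos.
by have [] := @xgetPex _ 0 _ (ex_intro (is_principal_log X) U0 U0X).
Qed.
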